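(* Let $T>0$, let $H:\mathbb{R}^2\times\mathbb{R}\to\mathbb{R}$, $H=H(x,t)$, be a Hamiltonian which is $T$-periodic in $t$, and let $x:\mathbb{R}/T\mathbb{Z}\to\mathbb{R}^2$ be a $T$-periodic solution of the Hamiltonian system $\dot x = J\,dH(x,t)$. Let $x^2$ denote the second iterate (double cover) of $x$, i.e. $x$ regarded as a $2T$-periodic solution. Suppose that $x$ and $x^2$ are both non-degenerate. Then $x$ is elliptic if and only if the Conley-Zehnder index $i_1(x^2)$ is odd; equivalently, $x$ is hyperbolic if and only if $i_1(x^2)$ is even.
   Context: Notation: $J=\begin{pmatrix}0&-1\\1&0\end{pmatrix}$; $dH$ and $d^2H$ are the gradient and the Hessian matrix of $H$ in the variable $x\in\mathbb{R}^2$ ($H$ is regular enough that $d^2H$ is continuous); $Sp(2)=\{A\in\mathbb{R}^{2\times2}: A^TJA=J\}=SL(2,\mathbb{R})$; $S^1$ is the unit circle in $\mathbb{C}$. Linearization. For a $T$-periodic solution $x$, let $\gamma=\gamma_x$ be the fundamental solution of the linearized equation: $\dot\gamma(t)=J\,d^2H(x(t),t)\gamma(t)$, $\gamma(0)=I$. Then $\gamma(t)\in Sp(2)$ for all $t$. The solution $x$ is non-degenerate if $\det(\gamma(T)-I)\ne0$. The solution $x$ is elliptic if the eigenvalues of $\gamma(T)$ lie in $S^1\setminus\{\pm1\}$, and hyperbolic if the eigenvalues of $\gamma(T)$ lie in $\mathbb{R}\setminus\{\pm1\}$. The iterate $x^2$ is the same solution viewed as a $2T$-periodic solution; its fundamental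 solution is the path $\gamma^2:[0,2T]\to Sp(2)$ given by $\gamma^2(t)=\gamma(t)$ for $0\le t\le T$ and $\gamma^2(t)=\gamma(t-T)\gamma(T)$ for $T\le t\le 2T$, and $x^2$ is non-degenerate if $\det(\gamma^2(2T)-I)\neq0$. Krein sign and rotation function. Let $G=-iJ$ and let $\langle\cdot,\cdot\rangle$ be the standard Hermitian product on $\mathbb{C}^2$. An eigenvalue $\lambda\in S^1\setminus\{\pm1\}$ of $A\in Sp(2)$ with eigenvector $v$ is Krein-positive if $\langle Gv,v\rangle>0$ (exactly one of $\lambda,\bar\lambda$ is Krein-positive). For the double eigenvalue $1$ or $-1$, one copy is regarded as Krein-positive and the other as Krein-negative. The rotation function $\rho:Sp(2)\to S^1$ is $\rho(A)=\lambda/|\lambda|$, where $\lambda,\lambda^{-1}$ are the eigenvalues of $A$, labelled so that either $|\lambda|<1$, or $|\lambda|=1$ and $\lambda$ is Krein-positive. The function $\rho$ is continuous. Conley-Zehnder index. Let $Sp(2)^{\pm}=\{A\in Sp(2): \pm\det(A-I)<0\}$, $M^+=\mathrm{diag}(2,\tfrac12)\in Sp(2)^+$ and $M^-=\mathrm{diag}(-2,-\tfrac12)\in Sp(2)^-$. Given $\tau>0$ and a continuous path $\gamma:[0,\tau]\to Sp(2)$ with $\gamma(0)=I$ and $\det(\gamma(\tau)-I)\ne0$, extend it to a continuous path $\tilde\gamma:[0,2\tau]\to Sp(2)$ such that $\tilde\gamma|_{[0,\tau]}=\gamma$, for $t\in[\tau,2\tau]$ the path stays in whichever of $Sp(2)^+$,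 $Sp(2)^-$ contains $\gamma(\tau)$, and $\tilde\gamma(2\tau)$ is the corresponding representative $M^+$ or $M^-$. Since $\rho(M^\pm)=\pm1$, the map $(\rho\circ\tilde\gamma)^2:[0,2\tau]\to S^1$ (square taken in $\mathbb{C}$) is a loop, and the Conley-Zehnder index is its degree, $i_1(\gamma)=\deg(\rho\circ\tilde\gamma)^2$; it is independent of the choice of extension. For a non-degenerate periodic solution, $i_1$ of the solution is $i_1$ of its fundamental solution over its period; thus $i_1(x^2)=i_1(\gamma^2)$, where $\gamma=\gamma_x$ is the fundamental solution of the linearized equation along $x$ and $\gamma^2:[0,2T]\to Sp(2)$ is the path given by $\gamma^2(t)=\gamma(t)$ for $0\le t\le T$ and $\gamma^2(t)=\gamma(t-T)\gamma(T)$ for $T\le t\le 2T$. *)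

(* Defs.v *)
From HB Require Import structures.
From mathcomp Require Import all_boot all_order all_algebra.
From mathcomp Require Import all_classical all_reals all_analysis.
From mathcomp Require Import complex.

Set Implicit Arguments.
Unset Strict Implicit.
Unset Printing Implicit Defensive.

Import Order.TTheory GRing.Theory Num.Theory.
Import numFieldNormedType.Exports.

Local Open Scope classical_set_scope.
Local Open Scope ring_scope.
Local Open Scope complex_scope.

Definition mx2 {K : pzRingType} (a b c d : K) : 'M[K]_2 :=
  \matrix_(i, j) if i == 0 then (if j == 0 then a else b)
                 else (if j == 0 then c else d).

Definition J2 {K : pzRingType} : 'M[K]_2 := mx2 0 (-1) 1 0.

Definition Sp2 {K : pzRingType} : set 'M[K]_2 :=
  [set A | A^T *m J2 *m A = J2].

Section Hamiltonian.
Context {R : realType}.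
Implicit Types (H : 'cV[R]_2 -> R -> R) (x : R -> 'cV[R]_2) (y : 'cV[R]_2).

Definition basis_vec (i : 'I_2) : 'cV[R]_2 := delta_mx i 0.

Definition partial (i : 'I_2) (f : 'cV[R]_2 -> R) : 'cV[R]_2 -> R :=
  fun y => 'D_(basis_vec i) f y.

Definition gradH H y t : 'cV[R]_2 := \col_i partial i (H ^~ t) y.

Definition hessH H y t : 'M[R]_2 :=
  \matrix_(i, j) partial i (partial j (H ^~ t)) y.

(* 'D_v f y is a total operator, so the existence of the first and second
   partial derivatives in the space variable is required separately; the
   Hessian is jointly continuous in space and time. No regularity in time
   beyond that is required. *)
Definition regular_hamiltonian H : Prop :=
  [/\ forall t y i, derivable (H ^~ t) y (basis_vec i),
      forall t y i j, derivable (partial j (H ^~ t)) y (basis_vec i)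
    & continuous (fun p : 'cV[R]_2 * R => hessH H p.1 p.2)].

Definition hamiltonian_solution H x : Prop :=
  forall t : R, is_derive t 1 x (J2 *m gradH H (x t) t).

Definition fundamental_solution H x (gamma : R -> 'M[R]_2) : Prop :=
  gamma 0 = 1%:M /\
  forall t : R, is_derive t 1 gamma (J2 *m hessH H (x t) t *m gamma t).

End Hamiltonian.

Section Spectrum.
Context {R : realType}.
Implicit Types (A : 'M[R]_2) (lam : R[i]).

Definition complexify A : 'M[R[i]]_2 := map_mx (real_complex R) A.

Definition elliptic A : Prop :=
  forall lam, eigenvalue (complexify A) lam ->
    [/\ `|lam| = 1, lam != 1 & lam != -1].

Definition hyperbolic A : Prop :=
  forall lam, eigenvalue (complexify A) lam ->
    [/\ lam \is Num.real, lam != 1 & lam != -1].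

Definition hermitian_product (v w : 'cV[R[i]]_2) : R[i] :=
  \sum_i v i 0 * (w i 0)^*.

Definition krein_form : 'M[R[i]]_2 := - (0 +i* 1) *: J2.

(* In R[i], 0 < z means that z is real and positive. Eigenvectors are columns
   here, whereas eigenvalue in the library is about row vectors. The two
   values 1 and -1, when they are eigenvalues, are double: one of the two
   copies counts as Krein-positive. *)
Definition krein_positive A lam : Prop :=
  eigenvalue (complexify A) lam /\
  (lam = 1 \/ lam = -1 \/
   exists v : 'cV[R[i]]_2,
     [/\ v != 0, complexify A *m v = lam *: v
       & 0 < hermitian_product (krein_form *m v) v]).

Definition rotation_eigenvalue A lam : Prop :=
  eigenvalue (complexify A) lam /\
  (`|lam| < 1 \/ (`|lam| = 1 /\ krein_positive A lam)).

(* On Sp2 there is exactly one rotation eigenvalue; outside Sp2 the value of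
   rotation is irrelevant. *)
Definition rotation A : R[i] :=
  xget 1 [set z | exists2 lam, rotation_eigenvalue A lam & z = lam / `|lam|].

End Spectrum.

Section ConleyZehnder.
Context {R : realType}.
Implicit Types (tau : R) (gamma : R -> 'M[R]_2).

Definition nondegenerate_path tau gamma : Prop := \det (gamma tau - 1%:M) != 0.

Definition Sp2plus : set 'M[R]_2 := [set A | Sp2 A /\ \det (A - 1%:M) < 0].
Definition Sp2minus : set 'M[R]_2 := [set A | Sp2 A /\ 0 < \det (A - 1%:M)].

Definition Mplus : 'M[R]_2 := mx2 2 0 0 (2^-1).
Definition Mminus : 'M[R]_2 := mx2 (-2) 0 0 (- 2^-1).

(* Paths on a segment are functions on R considered on that segment only. *)
Definition CZ_extension tau gamma (gamma' : R -> 'M[R]_2) : Prop :=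
  [/\ {within `[0, 2 * tau], continuous gamma'},
      forall t : R, 0 <= t <= 2 * tau -> Sp2 (gamma' t),
      forall t : R, 0 <= t <= tau -> gamma' t = gamma t
    & ((forall t : R, tau <= t <= 2 * tau -> Sp2plus (gamma' t)) /\
         gamma' (2 * tau) = Mplus) \/
      ((forall t : R, tau <= t <= 2 * tau -> Sp2minus (gamma' t)) /\
         gamma' (2 * tau) = Mminus)].

(* The loop f : [0, l] -> S^1 has degree k: it has a continuous angle, and the
   total variation of the angle is k turns. *)
Definition loop_degree (l : R) (f : R -> R[i]) (k : int) : Prop :=
  exists theta : R -> R,
    [/\ {within `[0, l], continuous theta},
        forall t : R, 0 <= t <= l -> f t = cos (theta t) +i* sin (theta t)
      & theta l - theta 0 = 2 * pi * k%:~R].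

(* The index does not depend on the extension; 0 is a junk value for data to
   which no extension applies. *)
Definition CZindex tau gamma : int :=
  xget 0 [set k | exists2 gamma', CZ_extension tau gamma gamma' &
                    loop_degree (2 * tau)
                      (fun t => rotation (gamma' t) ^+ 2) k].

Definition iterate2 (T : R) gamma : R -> 'M[R]_2 :=
  fun t => if t <= T then gamma t else gamma (t - T) *m gamma T.

End ConleyZehnder.

(* Main.v *)
Require Import Defs.
From HB Require Import structures.
From mathcomp Require Import all_boot all_order all_algebra.
From mathcomp Require Import all_classical all_reals all_analysis.
From mathcomp Require Import complex.
From mathcomp Require Import ring lra.

Set Implicit Arguments.
Unset Strict Implicit.
Unset Printing Implicit Defensive.

Import Order.TTheory GRing.Theory Num.Theory.
Import numFieldNormedType.Exports.

Local Open Scope ring_scope.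

(** Why the theorem holds. Along the linearized flow the determinant is 1, because
    the Hessian is symmetric ([derive_swap], [fundamental_solution_det]). For a real
    matrix [A] of determinant 1 the eigenvalues are the roots of
    [lam^2 - (\tr A) lam + 1], so away from the traces 2 and -2 the matrix is elliptic
    exactly when [(\tr A)^2 < 4] and hyperbolic otherwise ([ellipticP],
    [hyperbolicP]). The double cover ends at [A *m A] with [A = gamma T], whose trace is
    [(\tr A)^2 - 2]. Hence [A] is elliptic exactly when [\tr (A *m A) < 2], that is,
    when the end point of the iterated path has
    [\det (A *m A - 1) = 2 - \tr (A *m A) > 0] and lies in the negative component.

    For every nondegenerate path the parity of the index tells the component of its
    end point ([CZindex_parity]). An extended path starts at the identity, where the rotation
    is 1, and ends at [Mplus], where it is 1, or at [Mminus], where it is -1. The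
    angle of the rotation therefore changes by an even multiple of [pi] in the first
    case and by an odd multiple in the second, and the degree of the square counts
    these multiples ([square_angle_parity]).

    For this argument the rotation has to be continuous on the whole group; it is
    identified with an explicit continuous expression in the entries ([rotationE]).
    The index is a genuine degree, and not a default value, once an extension
    ([CZ_extension_exists]) and an angle along it ([circle_lift]) exist. In the
    positive component the default value 0 has the right parity, so the extension is
    built for the negative component only: the segment from the end point to the
    opposite of the identity, rescaled to determinant 1, never meets the trace 2,
    and diagonal matrices lead from there to [Mminus]. *)

(** * Two by two matrices *)

Lemma ord2P (i : 'I_2) : i = 0 \/ i = 1.
Proof. by case: i => [[|[|]]] // h; [left | right]; apply: val_inj. Qed.

Lemma sum2 (V : nmodType) (F : 'I_2 -> V) : \sum_i F i = F 0 + F 1.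
Proof.
by rewrite !big_ord_recl big_ord0 addr0; congr (_ + F _); apply: val_inj.
Qed.

Lemma mx2_eq (K : Type) (A B : 'M[K]_2) :
  A 0 0 = B 0 0 -> A 0 1 = B 0 1 -> A 1 0 = B 1 0 -> A 1 1 = B 1 1 -> A = B.
Proof.
move=> h00 h01 h10 h11; apply/matrixP => i j.
by case: (ord2P i) => ->; case: (ord2P j) => ->.
Qed.

Lemma mxtrace2 (K : pzRingType) (A : 'M[K]_2) : \tr A = A 0 0 + A 1 1.
Proof. by rewrite /mxtrace sum2. Qed.

Lemma det2 (K : comPzRingType) (A : 'M[K]_2) :
  \det A = A 0 0 * A 1 1 - A 0 1 * A 1 0.
Proof.
have h01 : lift 0 0 = 1 :> 'I_2 by apply: val_inj.
have h10 : lift 1 0 = 0 :> 'I_2 by apply: val_inj.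
rewrite (expand_det_row _ 0) sum2 /cofactor !det_mx11 !mxE /= h01 h10.
by rewrite expr0 expr1 mul1r mulN1r mulrN.
Qed.

Section mx2_entries.
Context {K : pzRingType} (a b c d : K).
Lemma mx2_00 : mx2 a b c d 0 0 = a. Proof. by rewrite mxE. Qed.
Lemma mx2_01 : mx2 a b c d 0 1 = b. Proof. by rewrite mxE. Qed.
Lemma mx2_10 : mx2 a b c d 1 0 = c. Proof. by rewrite mxE. Qed.
Lemma mx2_11 : mx2 a b c d 1 1 = d. Proof. by rewrite mxE. Qed.
End mx2_entries.
Definition mx2E := (@mx2_00, @mx2_01, @mx2_10, @mx2_11).

Lemma mulmx2E (K : pzRingType) (m n : nat)
    (A : 'M[K]_(m, 2)) (B : 'M[K]_(2, n)) i j :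
  (A *m B) i j = A i 0 * B 0 j + A i 1 * B 1 j.
Proof. by rewrite mxE sum2. Qed.

(** In dimension two, [A^T *m J2 *m A] is [\det A] times [J2], so the symplectic
    condition is a condition on the determinant alone. *)
Lemma Sp2_det (K : comPzRingType) (A : 'M[K]_2) : Sp2 A <-> \det A = 1.
Proof.
rewrite det2; split=> [/matrixP /(_ 1 0)|dA].
  by rewrite !(mulmx2E, mx2E, mxE, mulr0, mulr1) /= => <-; ring.
have dA' : A 0 0 * A 1 1 = 1 + A 0 1 * A 1 0 by rewrite -dA; ring.
by apply: mx2_eq; rewrite !(mulmx2E, mx2E, mxE); ring: dA'.
Qed.

Lemma det2_sub_scalar (K : comPzRingType) (A : 'M[K]_2) (lam : K) :
  \det (A - lam%:M) = lam ^+ 2 - \tr A * lam + \det A.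
Proof.
rewrite mxtrace2 !det2 !mxE /= !(mulr1n, mulr0n); ring.
Qed.

Lemma mxtrace2_sqr (K : comPzRingType) (A : 'M[K]_2) :
  \tr (A *m A) = \tr A ^+ 2 - 2 * \det A.
Proof. by rewrite !mxtrace2 det2 !mulmx2E; ring. Qed.

Lemma eigenvalue2 (F : fieldType) (A : 'M[F]_2) lam :
  eigenvalue A lam = (lam ^+ 2 - \tr A * lam + \det A == 0).
Proof.
rewrite -det2_sub_scalar /eigenvalue /eigenspace kermx_eq0 row_free_unit.
by rewrite unitmxE unitfE negbK.
Qed.

(** * Eigenvalues in terms of the trace *)

Section Spectrum.
Local Open Scope complex_scope.
Context {R : realType}.
Implicit Types (A : 'M[R]_2) (lam : R[i]).

Lemma eigenvalue_complexify A (p q : R) :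
  eigenvalue (complexify A) (p +i* q) <->
  p ^+ 2 - q ^+ 2 - \tr A * p + \det A = 0 /\ q * (2 * p - \tr A) = 0.
Proof.
rewrite eigenvalue2 /complexify det_map_mx trace_map_mx.
set t := \tr A; set d := \det A.
have -> : (p +i* q) ^+ 2 - t%:C * (p +i* q) + d%:C =
  (p ^+ 2 - q ^+ 2 - t * p + d) +i* (q * (2 * p - t)).
  by rewrite expr2; simpc; congr (_ +i* _); ring.
by rewrite eq_complex /=; split=> [/andP[/eqP -> /eqP ->]|[-> ->]]; rewrite ?eqxx.
Qed.

Lemma normc_eq1 (p q : R) : p ^+ 2 + q ^+ 2 = 1 -> `|p +i* q| = 1.
Proof. by move=> h; rewrite normc_def /= h sqrtr1. Qed.

(** The imaginary part of the characteristic equation factors as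
    [q * (2 * p - \tr A)]: an eigenvalue is either real or has real part half the
    trace, and in the second case the real part of the equation puts it on the
    unit circle. The size of the trace decides which case occurs. *)
Lemma eigenvalue_Sp2 A (p q : R) : \det A = 1 ->
  eigenvalue (complexify A) (p +i* q) ->
  (\tr A ^+ 2 < 4 /\ [/\ p = \tr A / 2, q != 0 & p ^+ 2 + q ^+ 2 = 1]) \/
  (4 <= \tr A ^+ 2 /\ [/\ q = 0, p != 0 & p ^+ 2 + 1 = \tr A * p]).
Proof.
move=> dA /eigenvalue_complexify; rewrite dA => -[hre /eqP].
rewrite mulf_eq0; case: (eqVneq q 0) => [q0 _|q0 /eqP hp].
  right; rewrite q0 in hre *.
  have hp : p ^+ 2 + 1 = \tr A * p by lra.
  have p0 : p != 0 by apply/eqP => p0; move: hp; rewrite p0; lra.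
  split; last by split.
  have p2 : 0 < p ^+ 2 by rewrite exprn_even_gt0 //= p0.
  have hsq : (\tr A ^+ 2 - 4) * p ^+ 2 = (p ^+ 2 - 1) ^+ 2.
    by rewrite mulrBl -exprMn -hp; ring.
  by rewrite -subr_ge0 -(pmulr_lge0 _ p2) hsq sqr_ge0.
have {}hp : p = \tr A / 2 by lra.
have q2 : 0 < q ^+ 2 by rewrite exprn_even_gt0 //= q0.
by left; split; first nra; split => //; nra.
Qed.

(** A large trace contradicts ellipticity because it makes the root
    [(\tr A + s) / 2] real, and a real number of modulus 1 is 1 or -1. *)
Lemma ellipticP A : \det A = 1 -> \tr A ^+ 2 != 4 ->
  elliptic A <-> \tr A ^+ 2 < 4.
Proof.
move=> dA tA; split=> [ell|tlt [p q] /(eigenvalue_Sp2 dA)].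
  rewrite ltNge; apply/negP => tge.
  pose s := Num.sqrt (\tr A ^+ 2 - 4).
  have s2 : s ^+ 2 = \tr A ^+ 2 - 4 by rewrite sqr_sqrtr // subr_ge0.
  have /ell[] : eigenvalue (complexify A) (((\tr A + s) / 2) +i* 0).
    by apply/eigenvalue_complexify; rewrite dA; split; nra.
  rewrite normc_def /= expr0n addr0 sqrtr_sqr => /complexI /eqP.
  rewrite eqr_norml ler01 andbT !eq_complex /= oppr0 !eqxx !andbT.
  by move=> /orP[/eqP ->|/eqP ->]; rewrite eqxx.
case=> [[_ [_ q0 pq]]|[]]; last by rewrite leNgt tlt.
by rewrite normc_eq1 // !eq_complex /= oppr0 !(negbTE q0) !andbF.
Qed.

Lemma hyperbolicP A : \det A = 1 -> \tr A ^+ 2 != 4 ->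
  hyperbolic A <-> ~~ (\tr A ^+ 2 < 4).
Proof.
move=> dA tA; split=> [hyp|]; last first.
  rewrite -leNgt => tge [p q] /(eigenvalue_Sp2 dA).
  case=> [[]|[_ [q0 p0 pt]]]; first by rewrite ltNge tge.
  rewrite q0 complex_real eqxx !eq_complex /= oppr0 eqxx !andbT; split=> //.
    by apply: contra_neq tA => p1; rewrite p1 in pt; nra.
  by apply: contra_neq tA => p1; rewrite p1 in pt; nra.
apply/negP => tlt.
pose q := Num.sqrt (1 - \tr A ^+ 2 / 4).
have q_gt0 : 0 < 1 - \tr A ^+ 2 / 4 by lra.
have q2 : q ^+ 2 = 1 - \tr A ^+ 2 / 4 by rewrite sqr_sqrtr // ltW.
have /hyp[] : eigenvalue (complexify A) ((\tr A / 2) +i* q).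
  by apply/eigenvalue_complexify; rewrite dA; split; nra.
by rewrite complex_real => /eqP qE; move: q2; rewrite qE; lra.
Qed.

End Spectrum.

(** * The rotation function in closed form *)

(** The rotation jumps between formulas according to the trace; truncations to
    symmetric intervals unite them into one expression that is visibly continuous. *)
Definition clamp {R : realDomainType} (m x : R) : R :=
  Num.max (- m) (Num.min m x).

Lemma clamp_ge {R : realDomainType} (m x : R) :
  0 <= m -> m <= x -> clamp m x = m.
Proof.
by move=> m0 mx; rewrite /clamp min_l // max_r // (le_trans _ m0) // oppr_le0.
Qed.

Lemma clamp_le {R : realDomainType} (m x : R) :
  0 <= m -> x <= - m -> clamp m x = - m.
Proof.
by move=> m0 mx; rewrite /clamp max_l // ge_min mx orbT.
Qed.

Lemma clamp_id {R : realDomainType} (m x : R) : `|x| <= m -> clamp m x = x.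
Proof. by rewrite ler_norml => /andP[? ?]; rewrite /clamp min_r // max_r. Qed.

Lemma clamp0 {R : realDomainType} (x : R) : clamp 0 x = 0.
Proof.
have [x0|/ltW x0] := leP 0 x; first exact: clamp_ge.
by rewrite -[RHS]oppr0; apply: clamp_le; rewrite ?oppr0.
Qed.

Section Rotation.
Local Open Scope complex_scope.
Context {R : realType}.
Implicit Types (A : 'M[R]_2) (lam : R[i]).

(** Real and imaginary part of the rotation, as functions of the entries. Below
    trace 2 in absolute value the eigenvalues are [\tr A / 2] plus or minus
    [rotation_radius A] times the imaginary unit, and the Krein-positive one is
    selected by the sign of [A 1 0 - A 0 1]. Since
    [((A 1 0 - A 0 1) / 2) ^+ 2 >= 1 - \tr A ^+ 2 / 4] when [\det A = 1],
    truncating [(A 1 0 - A 0 1) / 2] at that radius gives the radius with the right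
    sign; for larger traces the square root, hence the imaginary part, is 0. *)
Definition rotation_re A : R := clamp 1 (\tr A / 2).
Definition rotation_radius A : R := Num.sqrt (1 - \tr A ^+ 2 / 4).
Definition rotation_im A : R := clamp (rotation_radius A) ((A 1 0 - A 0 1) / 2).

Lemma rotation_nonreal_spectrum A : \det A = 1 -> \tr A ^+ 2 < 4 ->
  [/\ rotation_re A = \tr A / 2,
      rotation_im A = Num.sg (- A 0 1) * rotation_radius A,
      A 0 1 != 0 & 0 < rotation_radius A].
Proof.
move=> dA tA; have q_gt0 : 0 < 1 - \tr A ^+ 2 / 4 by lra.
have r_gt0 : 0 < rotation_radius A by rewrite sqrtr_gt0.
have r2 : rotation_radius A ^+ 2 = 1 - \tr A ^+ 2 / 4 by rewrite sqr_sqrtr // ltW.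
have dA' := dA; rewrite det2 in dA'.
rewrite mxtrace2 in tA r2.
have ad_sqr := sqr_ge0 (A 0 0 - A 1 1); have bc_sqr := sqr_ge0 (A 0 1 + A 1 0).
(* [4 * A 0 1 * A 1 0] is [(\tr A)^2 - 4 - (A 0 0 - A 1 1)^2]. *)
have bc : A 0 1 * A 1 0 < 0 by lra.
have r_le x : 0 < x -> x ^+ 2 = ((A 1 0 - A 0 1) / 2) ^+ 2 -> rotation_radius A <= x.
  move=> x0 xE; rewrite -ler_sqr ?nnegrE ?(ltW x0) ?(ltW r_gt0) // r2 xE; lra.
split=> //.
- rewrite /rotation_re mxtrace2 clamp_id // ler_norml; apply/andP; split; nra.
- rewrite /rotation_im; case: (ltgtP (A 0 1) 0) => [b0|b0|b0].
  + rewrite gtr0_sg ?oppr_gt0 // mul1r clamp_ge ?(ltW r_gt0) //.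
    by apply: r_le => //; nra.
  + rewrite ltr0_sg ?oppr_lt0 // mulN1r clamp_le ?(ltW r_gt0) // lerNr.
    by apply: r_le; [nra | rewrite sqrrN].
  + by move: bc; rewrite b0 mul0r ltxx.
- by apply/eqP => b0; move: bc; rewrite b0 mul0r ltxx.
Qed.

Lemma rotation_real_spectrum A : 4 <= \tr A ^+ 2 ->
  rotation_re A = Num.sg (\tr A) /\ rotation_im A = 0.
Proof.
move=> tA; split; last first.
  by rewrite /rotation_im /rotation_radius ler0_sqrtr ?clamp0 //; lra.
rewrite /rotation_re; case: (ltgtP (\tr A) 0) => [t0|t0|t0].
- by rewrite ltr0_sg // clamp_le //; nra.
- by rewrite gtr0_sg // clamp_ge //; nra.
- by rewrite t0 in tA *; rewrite expr0n /= in tA; lra.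
Qed.

(** For [v = (v0, v1)] the form [<Gv, v>] is twice the imaginary part of
    the product of [v0] with the conjugate of [v1]. *)
Lemma hermitian_krein (v : 'cV[R[i]]_2) :
  hermitian_product (krein_form *m v) v =
    (2 * (complex.Re (v 1 0) * complex.Im (v 0 0) -
          complex.Re (v 0 0) * complex.Im (v 1 0)))%:C.
Proof.
rewrite /hermitian_product sum2 /krein_form /J2 !(mulmx2E, mx2E, mxE).
case: (v 0 0) (v 1 0) => x1 y1 [x2 y2] /=; simpc.
by congr (_ +i* _); ring.
Qed.

(** An eigenvector satisfies [A 0 1 * v1 = (lam - A 0 0) * v0]; multiplying
    [hermitian_krein] by [A 0 1] therefore gives [- 2 * q * |v0|^2], so the Krein
    sign is read off from the signs of [A 0 1] and [q]. *)
Lemma krein_positiveP A (p q : R) : \det A = 1 -> q != 0 ->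
  eigenvalue (complexify A) (p +i* q) ->
  krein_positive A (p +i* q) <-> A 0 1 * q < 0.
Proof.
move=> dA q0 lamP.
have [[tA [pE _ pq]]|[_ []]] := eigenvalue_Sp2 dA lamP; last by move/eqP: q0.
have [_ _ b0 _] := rotation_nonreal_spectrum dA tA.
split=> [[_ [/eqP|[/eqP|]]]|bq].
- by rewrite eq_complex /= (negbTE q0) andbF.
- by rewrite eq_complex /= oppr0 (negbTE q0) andbF.
- case=> v [v0 vE]; rewrite hermitian_krein ltcR.
  move/matrixP/(_ 0 0) : vE; rewrite mulmx2E !mxE.
  case: (v 0 0) (v 1 0) => x1 y1 [x2 y2].
  rewrite /=; simpc => -[re im] vpos.
  have : A 0 1 * (x2 * y1 - x1 * y2) = - q * (x1 ^+ 2 + y1 ^+ 2).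
    have -> : A 0 1 * (x2 * y1 - x1 * y2) = (A 0 1 * x2) * y1 - x1 * (A 0 1 * y2).
      by ring.
    have -> : A 0 1 * x2 = p * x1 - q * y1 - A 0 0 * x1 by rewrite -re; ring.
    have -> : A 0 1 * y2 = p * y1 + q * x1 - A 0 0 * y1 by rewrite -im; ring.
    by ring.
  have xy : 0 <= x1 ^+ 2 + y1 ^+ 2 by rewrite addr_ge0 ?sqr_ge0.
  set w := x2 * y1 - x1 * y2 in vpos *; set n := x1 ^+ 2 + y1 ^+ 2 in xy * => wE.
  have w0 : 0 < w by lra.
  have b2 : 0 < A 0 1 ^+ 2 by rewrite exprn_even_gt0 //= b0.
  have : 0 < - (A 0 1 * q) * n.
    have -> : - (A 0 1 * q) * n = A 0 1 ^+ 2 * w by rewrite expr2 -mulrA wE; ring.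
    exact: mulr_gt0.
  by nra.
- split=> //; right; right.
  exists (\col_i if i == 0 then (A 0 1)%:C else (p - A 0 0) +i* q); split.
  + apply/eqP => /matrixP/(_ 0 0); rewrite !mxE /= => /eqP.
    by rewrite eq_complex /= (negbTE b0).
  + have bc : A 0 1 * A 1 0 = A 0 0 * A 1 1 - 1 by rewrite -dA det2; ring.
    rewrite mxtrace2 in pE.
    apply/matrixP => i j; rewrite ord1 mulmx2E !mxE /=.
    case: (ord2P i) => -> /=; simpc.
      by congr (_ +i* _); ring.
    congr (_ +i* _); last by rewrite pE; field.
    rewrite [A 1 0 * _]mulrC bc (_ : q * q = 1 - p ^+ 2); last by rewrite -pq; ring.
    by rewrite pE; field.
  + rewrite hermitian_krein ltcR !mxE /=; nra.
Qed.

Lemma rotation_eigenvalue_quotient A lam :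
  \det A = 1 -> rotation_eigenvalue A lam ->
  lam / `|lam| = rotation_re A +i* rotation_im A.
Proof.
case: lam => p q dA [lamP rot].
have [[tA [pE q0 pq]]|[tA [q0 p0 pt]]] := eigenvalue_Sp2 dA lamP.
  have n1 := normc_eq1 pq.
  case: rot => [|[_ /(krein_positiveP dA q0 lamP) bq]]; first by rewrite n1 ltxx.
  have [-> -> b0 r0] := rotation_nonreal_spectrum dA tA.
  rewrite n1 divr1 pE; congr (_ +i* _).
  have -> : rotation_radius A = `|q|.
    rewrite /rotation_radius -sqrtr_sqr; congr Num.sqrt.
    by move: pq; rewrite pE => pq; lra.
  case: (ltgtP (A 0 1) 0) => [b_lt0|b_gt0|bE].
  - rewrite nmulr_rlt0 // in bq.
    by rewrite gtr0_sg ?oppr_gt0 // gtr0_norm // mul1r.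
  - rewrite pmulr_rlt0 // in bq.
    by rewrite ltr0_sg ?oppr_lt0 // ltr0_norm // mulrNN mul1r.
  - by rewrite bE eqxx in b0.
have [-> ->] := rotation_real_spectrum tA.
rewrite q0 normc_def /= expr0n addr0 sqrtr_sqr.
have -> : Num.sg (\tr A) = Num.sg p.
  have tp : 0 < \tr A * p by rewrite -pt ltr_pwDr // sqr_ge0.
  move: p0; rewrite neq_lt => /orP[p_lt0|p_gt0].
    by rewrite nmulr_lgt0 // in tp; rewrite !ltr0_sg.
  by rewrite pmulr_lgt0 // in tp; rewrite !gtr0_sg.
rewrite complexr0 -fmorph_div /=; congr (_%:C).
by rewrite {1}[p]numEsg mulfK // normr_eq0.
Qed.

(** Below trace 2 in absolute value the imaginary part gets the sign opposite to
    [A 0 1], as [krein_positiveP] demands; above, the root of smaller modulus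
    is taken. *)
Lemma rotation_eigenvalue_exists A :
  \det A = 1 -> exists lam, rotation_eigenvalue A lam.
Proof.
move=> dA; case: (ltP (\tr A ^+ 2) 4) => tA.
  have [_ _ b0 r0] := rotation_nonreal_spectrum dA tA.
  have r2 : rotation_radius A ^+ 2 = 1 - \tr A ^+ 2 / 4 by rewrite sqr_sqrtr //; lra.
  pose q := - Num.sg (A 0 1) * rotation_radius A.
  have q2 : q ^+ 2 = 1 - \tr A ^+ 2 / 4.
    by rewrite /q exprMn sqrrN sqr_sg b0 mul1r.
  have lamP : eigenvalue (complexify A) ((\tr A / 2) +i* q).
    by apply/eigenvalue_complexify; rewrite dA; split; [rewrite q2|]; field.
  have bq : A 0 1 * q < 0.
    rewrite /q mulNr mulrN oppr_lt0 mulrA [A 0 1 * _]mulrC -normrEsg.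
    by rewrite mulr_gt0 ?normr_gt0.
  have q0 : q != 0 by apply/eqP => q0; move: bq; rewrite q0 mulr0 ltxx.
  exists ((\tr A / 2) +i* q); split=> //; right; split.
    by rewrite normc_eq1 // q2; field.
  by apply/(krein_positiveP dA q0 lamP).
pose s := Num.sqrt (\tr A ^+ 2 - 4).
have s0 : 0 <= s by exact: sqrtr_ge0.
have s2 : s ^+ 2 = \tr A ^+ 2 - 4 by rewrite sqr_sqrtr // subr_ge0.
pose p := (\tr A - Num.sg (\tr A) * s) / 2.
have t0 : \tr A != 0 by apply/eqP => t0; move: tA; rewrite t0 expr0n /=; lra.
have sg2 : Num.sg (\tr A) ^+ 2 = 1 by rewrite sqr_sg t0.
have lamP : eigenvalue (complexify A) (p%:C).
  apply/eigenvalue_complexify; rewrite dA mul0r; split=> //.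
  have -> : p ^+ 2 - 0 ^+ 2 - \tr A * p + 1 =
    1 + (Num.sg (\tr A) ^+ 2 * s ^+ 2 - \tr A ^+ 2) / 4 by rewrite /p; field.
  by rewrite sg2 s2; field.
have u0 : 0 <= `|\tr A| by [].
have u2 : s ^+ 2 = `|\tr A| ^+ 2 - 4 by rewrite s2 real_normK // num_real.
(* With [u] the absolute value of the trace, [u - 2 <= s <= u + 2], because
   [s^2 = (u - 2) (u + 2)] and [u >= 2]. *)
have p_le1 : `|p| <= 1.
  have -> : p = Num.sg (\tr A) * ((`|\tr A| - s) / 2).
    by rewrite mulrA mulrBr -numEsg.
  rewrite normrM normr_sg t0 mul1r ler_norml; apply/andP; split; nra.
exists p%:C; split=> //.
have -> : `|p%:C| = `|p|%:C by rewrite normc_def /= expr0n addr0 sqrtr_sqr.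
move: p_le1; rewrite le_eqVlt => /orP[/eqP p1|p1]; last by left; rewrite ltcR.
right; rewrite p1; split=> //; split=> //.
move/eqP: p1; rewrite eqr_norml ler01 andbT => /orP[/eqP ->|/eqP ->].
  by left.
by right; left; rewrite rmorphN.
Qed.

(** The quotient of every rotation eigenvalue by its modulus is the closed form,
    and there is at least one, so the choice made by [xget] is immaterial. *)
Lemma rotationE A : \det A = 1 -> rotation A = rotation_re A +i* rotation_im A.
Proof.
move=> dA; have [lam lamP] := rotation_eigenvalue_exists dA.
rewrite /rotation; case: xgetP => [z _ /= [mu muP ->]|/(_ (lam / `|lam|)) []].
  exact: rotation_eigenvalue_quotient.
by exists lam.
Qed.

End Rotation.

(** * Angles of circle-valued functions *)

Section MaxMinContinuity.
Context {R : realType} {T : topologicalType}.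
Implicit Types f g : T -> R.

Lemma continuous_maxr f g :
  continuous f -> continuous g -> continuous (fun t => Num.max (f t) (g t)).
Proof. by move=> fc gc t; exact: (continuous_max (fc t) (gc t)). Qed.

Lemma continuous_minr f g :
  continuous f -> continuous g -> continuous (fun t => Num.min (f t) (g t)).
Proof. by move=> fc gc t; exact: (continuous_min (fc t) (gc t)). Qed.

End MaxMinContinuity.

Section Circle.
Local Open Scope classical_set_scope.
Context {R : realType}.
Implicit Types (c s theta : R -> R) (l : R).

(** Continuity at one time gives a [d] for nearby times, and compactness of the
    interval makes it uniform. A positive inner product of two unit vectors says
    that they are less than a quarter turn apart. *)
Lemma circle_uniformly_acute c s l : continuous c -> continuous s ->
  (forall t, c t ^+ 2 + s t ^+ 2 = 1) ->
  exists2 d : R, 0 < d &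
    forall u v, 0 <= u <= l -> `|v - u| <= d -> 0 < c u * c v + s u * s v.
Proof.
move=> cc sc cs1.
have /compact_near_coveringP/near_covering_withinP cov := @segment_compact R 0 l.
have /cov : forall u, `[0, l]%classic u -> \forall u' \near u & d \near 0^'+,
    `[0, l]%classic u' -> forall v, `|v - u'| <= d -> 0 < c u' * c v + s u' * s v.
  move=> u _.
  have /cvgrPdist_lt/(_ 1 ltr01) : (c x.1 * c x.2 + s x.1 * s x.2)
      @[x --> (u, u)] --> c u * c u + s u * s u.
    apply: cvgD; apply: cvgM; (apply: continuous_cvg; [exact: cc || exact: sc|]);
      by [exact: cvg_fst | exact: cvg_snd].
  rewrite -!expr2 cs1 => -[[A B] /=].
  move=> [/nbhs_ballP[a /= a0 aA] /nbhs_ballP[b /= b0 bB]] AB.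
  exists (ball u (Num.min a (b / 2)), `]0, b / 2[%classic) => /=.
    split; first by apply: nbhsx_ballx; rewrite lt_min a0 divr_gt0.
    near=> x; rewrite /= in_itv /=; apply/andP; split => //.
    by near: x; apply: nbhs_right_lt; rewrite divr_gt0.
  move=> [u' d] /= []; rewrite /ball /= lt_min => /andP[ua ub].
  rewrite in_itv /= => /andP[d0 db] _ v vd.
  have {AB} : `|1 - (c u' * c v + s u' * s v)| < 1.
    apply: (AB (u', v)); split => /=; first exact: aA.
    apply: bB; rewrite /ball /= (_ : u - v = (u - u') - (v - u')); last by ring.
    rewrite (le_lt_trans (ler_normB _ _)) // (splitr b) ltrD //.
    exact: le_lt_trans vd db.
  by rewrite ltr_distlC subrr => /andP[? _].
move=> [d /= d0 dP]; exists (d / 2); first by rewrite divr_gt0.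
move=> u v ul vd; apply: (dP (d / 2)) => //=.
- by rewrite sub0r normrN gtr0_norm ?divr_gt0 // gtr_pMr // invf_lt1 ?ltr1n.
- by rewrite divr_gt0.
Unshelve. all: by end_near. Qed.

Lemma cos_sin_atan (x y : R) : 0 < x -> x ^+ 2 + y ^+ 2 = 1 ->
  cos (atan (y / x)) = x /\ sin (atan (y / x)) = y.
Proof.
move=> x0 xy.
have cE : cos (atan (y / x)) = x.
  rewrite cos_atan (_ : 1 + _ = x ^- 2); last first.
    have x2 : x ^+ 2 != 0 by exact/expf_neq0/lt0r_neq0.
    by rewrite expr_div_n -[X in X + _](mulfV x2) -mulrDl xy mul1r.
  by rewrite sqrtrV ?sqr_ge0 // sqrtr_sqr invrK gtr0_norm.
split=> //; have := atanK (y / x); rewrite /tan cE => /divIf -> //.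
by rewrite gt_eqF.
Qed.

(** The angle is built in steps of length [d]. On each step the curve stays
    within a quarter turn of its value at the start [u] of the step, so the angle
    gained since [u] is an arctangent. *)
Lemma circle_lift c s l : continuous c -> continuous s ->
  (forall t, c t ^+ 2 + s t ^+ 2 = 1) ->
  exists2 theta, continuous theta &
    forall t, 0 <= t <= l -> c t = cos (theta t) /\ s t = sin (theta t).
Proof.
move=> cc sc cs1; have [d d0 dP] := circle_uniformly_acute l cc sc cs1.
suff lift n : exists2 theta, continuous theta &
    forall t, 0 <= t <= l -> t <= n%:R * d ->
    c t = cos (theta t) /\ s t = sin (theta t).
  have [theta thc thE] := lift (Num.truncn (l / d)).+1.
  exists theta => // t tl; apply: thE => //; case/andP: tl => t0 tl.
  by rewrite (le_trans tl) // -ler_pdivrMr // ltW // truncnS_gt.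
elim: n => [|n [theta thc thE]].
  have c01 : -1 <= c 0 <= 1.
    rewrite -ler_norml -(@expr_le1 _ 2) // real_normK ?num_real //.
    by rewrite -(cs1 0) lerDl sqr_ge0.
  have sE : Num.sqrt (1 - c 0 ^+ 2) = `|s 0|.
    by rewrite -sqrtr_sqr; congr Num.sqrt; rewrite -(cs1 0); ring.
  exists (fun=> if 0 <= s 0 then acos (c 0) else - acos (c 0)).
    by move=> t; exact: cvg_cst.
  move=> t /andP[t0 _]; rewrite mul0r => t0'.
  have -> : t = 0 by apply/eqP; rewrite eq_le t0 t0'.
  case: leP => s0; rewrite ?cosN ?sinN acosK // sin_acos // sE.
    by rewrite ger0_norm.
  by rewrite ltr0_norm // opprK.
pose u := n%:R * d.
have u0 : 0 <= u by rewrite mulr_ge0 // ltW.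
case: (leP u l) => ul; last first.
  exists theta => // t tl _; apply: thE => //.
  by case/andP: tl => _ /le_trans -> //; exact: ltW.
(* [v] is the time, frozen outside the current step; [x + i y] is the value of the
   curve at time [v t] divided by its value at time [u]. *)
pose v t := Num.max u (Num.min t (u + d)).
pose x t := c u * c (v t) + s u * s (v t).
pose y t := c u * s (v t) - s u * c (v t).
have vc : continuous v.
  apply: continuous_maxr; first by move=> t; exact: cvg_cst.
  by apply: continuous_minr => t; [exact: cvg_id | exact: cvg_cst].
have cvc : continuous (c \o v).
  by move=> t; apply: continuous_comp; [exact: vc | exact: cc].
have svc : continuous (s \o v).
  by move=> t; apply: continuous_comp; [exact: vc | exact: sc].
have x0 t : 0 < x t.
  apply: dP; first by rewrite u0 ul.
  rewrite ger0_norm; last by rewrite subr_ge0 le_max lexx.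
  by rewrite lerBlDr ge_max addrC lerDl (ltW d0) ge_min lexx orbT.
have xc : continuous x.
  move=> t; apply: cvgD; apply: cvgM;
    by [exact: cvg_cst | exact: cvc | exact: svc].
have yc : continuous y.
  move=> t; apply: cvgB; apply: cvgM;
    by [exact: cvg_cst | exact: cvc | exact: svc].
exists (fun t => theta (Num.min t u) + atan (y t / x t)).
  move=> t; apply: cvgD.
    apply: (continuous_comp (f := fun t => Num.min t u)); last exact: thc.
    by apply: continuous_minr => ?; [exact: cvg_id | exact: cvg_cst].
  apply: (continuous_comp (f := fun t => y t / x t)); last exact: continuous_atan.
  by apply: cvgM; [exact: yc | apply: cvgV; [rewrite gt_eqF | exact: xc]].
move=> t tl tn; have [tu|/ltW ut] := leP t u.
  have vE : v t = u by rewrite /v max_l // ge_min tu.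
  have -> : y t = 0 by rewrite /y vE; ring.
  by rewrite mul0r atan0 addr0; exact: thE.
have vE : v t = t.
  by rewrite /v min_l ?max_r // (le_trans tn) // -natr1 mulrDl mul1r.
have [] := thE u; rewrite ?u0 // => cu su.
have xy1 : x t ^+ 2 + y t ^+ 2 = 1.
  by rewrite -[1]mulr1 -{1}(cs1 u) -(cs1 (v t)) /x /y; ring.
have [cosE sinE] := cos_sin_atan (x0 t) xy1.
rewrite cosD sinD cosE sinE -cu -su /x /y vE; split.
  by rewrite -[LHS]mul1r -(cs1 u); ring.
by rewrite -[LHS]mul1r -(cs1 u); ring.
Qed.
End Circle.

(** * Parity of the degree of a square *)

Section Parity.
Local Open Scope classical_set_scope.
Local Open Scope complex_scope.
Context {R : realType}.
Implicit Types (c s theta : R -> R) (l : R).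

Lemma alternating_int (f : R -> R) (p : R) : alternating f p ->
  forall (k : int) (a : R), f (a + p * k%:~R) = (-1) ^+ odd `|k|%N * f a.
Proof.
move=> fp k a; rewrite signr_odd; case: k => n.
  by rewrite mulr_natr (alternatingn fp).
rewrite NegzE mulrNz mulrN -pmulrn mulr_natr abszN /=.
have := alternatingn fp n.+1 (a - p *+ n.+1).
by rewrite subrK => ->; rewrite mulrA -expr2 sqrr_sign mul1r.
Qed.

(** The curve [c + i s] and the half angle [exp (i theta / 2)] have the same
    square, so their quotient is 1 or -1 at each time, hence constant. At time [l]
    the half angle has turned by [pi * k], which multiplies it by [(-1) ^ k], while
    the curve has moved from 1 to [c l]. *)
Lemma square_angle_parity c s theta l (k : int) : 0 <= l ->
  {within `[0, l], continuous c} -> {within `[0, l], continuous s} ->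
  {within `[0, l], continuous theta} ->
  (forall t, 0 <= t <= l -> (c t +i* s t) ^+ 2 = cos (theta t) +i* sin (theta t)) ->
  c 0 = 1 -> s 0 = 0 -> s l = 0 -> theta l - theta 0 = 2 * pi * k%:~R ->
  c l = (-1) ^+ odd `|k|%N.
Proof.
move=> l0 cc sc thc sqE c0 s0 sl thk.
(* [g] is the real part of the quotient of the curve by the half angle. *)
pose g t := c t * cos (theta t / 2) + s t * sin (theta t / 2).
have gc : {within `[0, l], continuous g}.
  move=> t; apply: cvgD; apply: cvgM; try by [exact: cc | exact: sc].
    apply: (continuous_comp (f := fun t : subspace `[0, l] => theta t / 2)).
      by apply: cvgM; [exact: thc | exact: cvg_cst].
    exact: continuous_cos.
  apply: (continuous_comp (f := fun t : subspace `[0, l] => theta t / 2)).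
    by apply: cvgM; [exact: thc | exact: cvg_cst].
  exact: continuous_sin.
have halves t : 0 <= t <= l -> [/\ c t ^+ 2 = cos (theta t / 2) ^+ 2,
    s t ^+ 2 = sin (theta t / 2) ^+ 2 &
    c t * s t = cos (theta t / 2) * sin (theta t / 2)].
  move=> /sqE; rewrite {1 2}(splitr (theta t)) cosD sinD expr2.
  have := cos2Dsin2 (theta t / 2).
  set C := cos _; set S := sin _ => CS; simpc => -[re im].
  have cs1 : (c t ^+ 2 + s t ^+ 2) ^+ 2 = 1.
    have -> : (c t ^+ 2 + s t ^+ 2) ^+ 2 =
      (c t * c t - s t * s t) ^+ 2 + (c t * s t + s t * c t) ^+ 2 by ring.
    by rewrite re im -[1](expr1n _ 2) -CS; ring.
  have cs : c t ^+ 2 + s t ^+ 2 = 1.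
    have h0 : 0 <= c t ^+ 2 + s t ^+ 2 by rewrite addr_ge0 ?sqr_ge0.
    by move/eqP: cs1; rewrite sqrf_eq1 => /orP[/eqP //|/eqP hN]; lra.
  by split; lra.
have g2 t : 0 <= t <= l -> g t ^+ 2 = 1.
  move=> tl; have [h1 h2 h3] := halves t tl.
  have -> : g t ^+ 2 =
      c t ^+ 2 * cos (theta t / 2) ^+ 2 + s t ^+ 2 * sin (theta t / 2) ^+ 2
      + 2 * (c t * s t) * (cos (theta t / 2) * sin (theta t / 2)).
    by rewrite /g; ring.
  have cs1 : c t ^+ 2 + s t ^+ 2 = 1 by rewrite h1 h2 cos2Dsin2.
  rewrite -h1 -h2 -h3; transitivity ((c t ^+ 2 + s t ^+ 2) ^+ 2); first by ring.
  by rewrite cs1 expr1n.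
have [l_in0 l_inl] : 0 <= (0 : R) <= l /\ 0 <= l <= l by rewrite !lexx l0.
have g0l : g 0 = g l.
  have : (g l - g 0) * (g l + g 0) = 0.
    by rewrite -subr_sqr !g2 // subrr.
  move/eqP; rewrite mulf_eq0 subr_eq0 addr_eq0 => /orP[/eqP // |/eqP glN].
  have [t] : exists2 t, t \in `[0, l]%R & g t = 0.
    apply: (IVT l0 gc); rewrite glN.
    by case: (leP (- g 0) (g 0)) => h; apply/andP; split; lra.
  rewrite in_itv => /g2 /[swap] ->.
  by rewrite expr0n => /eqP; rewrite eq_sym oner_eq0.
have g20 := g2 0 l_in0.
move: g20 g0l; rewrite /g c0 s0 sl !mul0r !addr0 mul1r => C2.
have -> : theta l / 2 = theta 0 / 2 + pi * k%:~R.
  by rewrite -[theta l](subrK (theta 0)) thk; field.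
rewrite (alternating_int (@cosDpi R)) => gE.
have C0 : cos (theta 0 / 2) != 0.
  by apply/eqP => C0; move: C2; rewrite C0 expr0n => /eqP; rewrite eq_sym oner_eq0.
apply: (mulIf C0).
by rewrite [in RHS]gE mulrCA [X in _ = _ * X]mulrA -expr2 sqrr_sign mul1r.
Qed.

Lemma sin_eq0_int (a : R) : sin a = 0 -> exists k : int, a = pi * k%:~R.
Proof.
move=> sa; exists (Num.floor (a / pi)); set k := Num.floor _.
have b0 : 0 <= a - pi * k%:~R.
  by rewrite subr_ge0 mulrC -ler_pdivlMr ?pi_gt0 // floor_le.
have bpi : a - pi * k%:~R < pi.
  rewrite ltrBlDr -[X in X + _]mulr1 -mulrDr mulrC -ltr_pdivrMr ?pi_gt0 //.
  by rewrite addrC -intrD1 floorD1_gt.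
move: b0; rewrite le_eqVlt => /orP[|b_gt0]; first by rewrite eq_sym subr_eq0 => /eqP.
have := sin_gt0_pi (x := a - pi * k%:~R); rewrite b_gt0 bpi => /(_ isT).
move: sa; rewrite -[a in sin a](subrK (pi * k%:~R)) (alternating_int (@sinDpi R)).
by move/eqP; rewrite mulf_eq0 signr_eq0 => /eqP ->; rewrite ltxx.
Qed.

End Parity.

(** * Degree of the squared rotation along a matrix path *)

Section MatrixContinuity.
Local Open Scope classical_set_scope.
Context {R : realType}.

(** The norm of a matrix is the maximum of the norms of its entries. *)
Lemma cvg_mx {T : Type} {F : set_system T} {FF : Filter F} m n
    (f : T -> 'M[R]_(m, n)) (L : 'M[R]_(m, n)) :
  (forall i j, f x i j @[x --> F] --> L i j) -> f x @[x --> F] --> L.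
Proof.
move=> fL; apply/cvgrPdist_le => /= e e0; near=> x.
rewrite /Num.Def.normr/= mx_normrE (bigmax_le _ (ltW e0))//= => i _.
rewrite !mxE/=.
move: i; near: x; apply: filter_forall => /= i.
exact: ((cvgrPdist_le _ _).1 (fL i.1 i.2)).
Unshelve. all: by end_near. Qed.

Lemma cvg_coord {T : Type} {F : set_system T} {FF : Filter F} m n
    (f : T -> 'M[R]_(m, n)) (L : 'M[R]_(m, n)) i j :
  f x @[x --> F] --> L -> f x i j @[x --> F] --> L i j.
Proof.
by move=> fL; exact: (cvg_comp _ _ fL (@coord_continuous _ _ _ i j L)).
Qed.

Context {T : topologicalType}.
Implicit Types f g : T -> 'M[R]_2.

Lemma continuous_mulmx2 f g :
  continuous f -> continuous g -> continuous (fun t => f t *m g t).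
Proof.
move=> fc gc t; apply: cvg_mx => i j.
rewrite mulmx2E; under eq_fun do rewrite mulmx2E.
by apply: cvgD; apply: cvgM; apply: cvg_coord; by [exact: fc | exact: gc].
Qed.

Lemma continuous_mx2 (a b c d : T -> R) :
  continuous a -> continuous b -> continuous c -> continuous d ->
  continuous (fun t => mx2 (a t) (b t) (c t) (d t)).
Proof.
move=> ac bc cc dc t; apply: cvg_mx => i j.
by case: (ord2P i) => ->; case: (ord2P j) => ->; rewrite mx2E;
  under eq_fun do rewrite mx2E; [exact: ac | exact: bc | exact: cc | exact: dc].
Qed.

Lemma continuous_mxtrace2 f : continuous f -> continuous (fun t => \tr (f t)).
Proof.
move=> fc.
rewrite (_ : (fun t => _) = fun t => f t 0 0 + f t 1 1) => [t|]; last first.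
  by apply/funext => t; exact: mxtrace2.
by apply: cvgD; apply: cvg_coord; exact: fc.
Qed.

Lemma continuous_clamp (m x : T -> R) :
  continuous m -> continuous x -> continuous (fun t => clamp (m t) (x t)).
Proof.
move=> mc xc; apply: continuous_maxr; last exact: continuous_minr.
by move=> t; apply: cvgN; exact: mc.
Qed.

Lemma continuous_rotation_re f : continuous f -> continuous (fun t => rotation_re (f t)).
Proof.
move=> fc; apply: continuous_clamp => t; first exact: cvg_cst.
by apply: cvgM; [exact: continuous_mxtrace2 | exact: cvg_cst].
Qed.

Lemma continuous_rotation_im f : continuous f -> continuous (fun t => rotation_im (f t)).
Proof.
move=> fc; apply: continuous_clamp => t.
  apply: (continuous_comp (f := fun t => 1 - \tr (f t) ^+ 2 / 4)).
    apply: cvgB; first exact: cvg_cst.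
    apply: cvgM; last exact: cvg_cst.
    by apply: (cvgM (f := fun t => \tr (f t)) (g := fun t => \tr (f t)));
      exact: continuous_mxtrace2.
  exact: sqrt_continuous.
apply: cvgM; last exact: cvg_cst.
by apply: cvgB; apply: cvg_coord; exact: fc.
Qed.

End MatrixContinuity.

Section LoopDegree.
Local Open Scope classical_set_scope.
Local Open Scope complex_scope.
Context {R : realType}.

Lemma rotation_re2_im2 (A : 'M[R]_2) : \det A = 1 ->
  rotation_re A ^+ 2 + rotation_im A ^+ 2 = 1.
Proof.
move=> dA; case: (ltP (\tr A ^+ 2) 4) => tA.
  have [-> -> b0 _] := rotation_nonreal_spectrum dA tA.
  rewrite [X in _ + X]exprMn sqr_sg oppr_eq0 b0 mul1r sqr_sqrtr; last by lra.
  by field.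
have [-> ->] := rotation_real_spectrum tA; rewrite sqr_sg expr0n addr0.
have -> // : \tr A != 0.
by apply/eqP => t0; move: tA; rewrite t0 expr0n /=; lra.
Qed.

(** At a matrix of trace at least 2 in absolute value the rotation is the sign of
    the trace, so this is [square_angle_parity] for the rotation along the path. *)
Lemma rotation_loop_degree_parity (gamma : R -> 'M[R]_2) (l : R) (k : int) : 0 <= l ->
  {within `[0, l], continuous gamma} ->
  (forall t, 0 <= t <= l -> \det (gamma t) = 1) ->
  gamma 0 = 1%:M -> 4 <= \tr (gamma l) ^+ 2 ->
  loop_degree l (fun t => rotation (gamma t) ^+ 2) k ->
  Num.sg (\tr (gamma l)) = (-1) ^+ odd `|k|%N.
Proof.
move=> l0 gc g1 g0 gl [theta [thc thE thk]].
have [rel iml] := rotation_real_spectrum gl.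
have tr0 : \tr (gamma 0) = 2 by rewrite g0 mxtrace1.
have [re0 im0] : rotation_re (gamma 0) = Num.sg (\tr (gamma 0)) /\
    rotation_im (gamma 0) = 0.
  by apply: rotation_real_spectrum; rewrite tr0 -natrX ler_nat.
rewrite tr0 gtr0_sg // in re0; rewrite -rel.
apply: (square_angle_parity (c := fun t => rotation_re (gamma t))
  (s := fun t => rotation_im (gamma t)) l0 _ _ thc _ re0 im0 iml thk).
- exact: (continuous_rotation_re (f := (gamma : subspace `[0, l] -> _)) gc).
- exact: (continuous_rotation_im (f := (gamma : subspace `[0, l] -> _)) gc).
- by move=> t tl; rewrite -thE // rotationE // g1.
Qed.

(** Twice an angle of the rotation is an angle of its square. Where the rotation
    is real the angle is a multiple of [pi], so the total variation of twice the
    angle is a whole number of turns. *)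
Lemma rotation_loop_degree_exists (gamma : R -> 'M[R]_2) (l : R) : 0 <= l ->
  continuous gamma -> (forall t, \det (gamma t) = 1) ->
  4 <= \tr (gamma 0) ^+ 2 -> 4 <= \tr (gamma l) ^+ 2 ->
  exists k, loop_degree l (fun t => rotation (gamma t) ^+ 2) k.
Proof.
move=> l0 gc g1 g0 gl.
have [alpha alphac alphaE] := circle_lift l (continuous_rotation_re gc)
  (continuous_rotation_im gc) (fun t => rotation_re2_im2 (g1 t)).
have alpha_int t : 0 <= t <= l -> 4 <= \tr (gamma t) ^+ 2 ->
    exists k : int, alpha t = pi * k%:~R.
  move=> tl /rotation_real_spectrum[_ im0]; apply: sin_eq0_int.
  by rewrite -im0; have [_ ->] := alphaE t tl.
have [k0 k0E] := alpha_int 0 ltac:(by rewrite lexx l0) g0.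
have [kl klE] := alpha_int l ltac:(by rewrite lexx l0) gl.
exists (kl - k0); exists (fun t => alpha t + alpha t); split.
- by apply: continuous_subspaceT => t; apply: cvgD; exact: alphac.
- move=> t tl; rewrite rotationE // expr2 cosD sinD.
  by have [-> ->] := alphaE t tl; simpc; congr (_ +i* _); ring.
- by rewrite k0E klE intrB; ring.
Qed.
End LoopDegree.

(** * Symmetry of the second derivative *)

Section Schwarz.
Local Open Scope classical_set_scope.
Context {R : realType} {V : normedModType R}.
Implicit Types (f : V -> R) (x u v : V).

Lemma is_derive_line f x u (s : R) : derivable f (x + s *: u) u ->
  is_derive s (1 : R) (fun r => f (x + r *: u)) ('D_u f (x + s *: u)).
Proof.
have quotE : (fun h : R => h^-1 *:
      (((fun r => f (x + r *: u)) \o shift s) (h *: (1 : R)) - f (x + s *: u))) =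
    (fun h : R => h^-1 *: ((f \o shift (x + s *: u)) (h *: u) - f (x + s *: u))).
  apply/funext => h /=; congr (_ *: (f _ - _)).
  by rewrite [h *: (1 : R)]mulr1 scalerDl addrA addrAC addrC.
move=> df; split; first by rewrite /derivable quotE.
by rewrite /derive quotE.
Qed.

Lemma is_derive_translate f x u (w : V) : derivable f (x + w) u ->
  is_derive x u (fun y => f (y + w)) ('D_u f (x + w)).
Proof.
have quotE : (fun h : R => h^-1 *:
      (((fun y => f (y + w)) \o shift x) (h *: u) - f (x + w))) =
    (fun h : R => h^-1 *: ((f \o shift (x + w)) (h *: u) - f (x + w))).
  by apply/funext => h /=; rewrite addrA.
move=> df; split; first by rewrite /derivable quotE.
by rewrite /derive quotE.
Qed.

Lemma mean_value_line f x u (h : R) : 0 < h -> (forall y, derivable f y u) ->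
  exists2 s, 0 < s < h & f (x + h *: u) - f x = h * 'D_u f (x + s *: u).
Proof.
move=> h0 df.
have dline s := is_derive_line (df (x + s *: u)).
have [|s sh] := MVT h0 (fun s _ => dline s).
  by apply: derivable_within_continuous => s _; exact: ex_derive.
rewrite scale0r addr0 subr0 => ->.
by exists s; [rewrite in_itv in sh | rewrite mulrC].
Qed.

(** Mean value theorem twice: first along [u] for the increment of [f] in
    direction [v], then along [v] for the derivative in direction [u]. *)
Lemma mixed_difference f x u v (h : R) : 0 < h ->
  (forall y, derivable f y u) -> (forall y, derivable ('D_u f) y v) ->
  exists s r, [/\ 0 < s < h, 0 < r < h &
    f (x + h *: u + h *: v) - f (x + h *: u) - f (x + h *: v) + f x
      = h * (h * 'D_v ('D_u f) (x + s *: u + r *: v))].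
Proof.
move=> h0 du duv.
pose g y := f (y + h *: v) - f y.
have dg y : is_derive y u g ('D_u f (y + h *: v) - 'D_u f y).
  by apply: is_deriveB; [exact: is_derive_translate | exact: derivableP].
have [|s sh gE] := @mean_value_line g x u h h0.
  by move=> y; exact: ex_derive.
have [r rh rE] := @mean_value_line ('D_u f) (x + s *: u) v h h0 duv.
exists s, r; split => //.
rewrite -rE -[_ - 'D_u f (x + s *: u)](derive_val (f := g)) -gE /g.
by rewrite opprB [f x - _]addrC addrA.
Qed.

Lemma continuous_eq_near (F G : V -> R) x :
  {for x, continuous F} -> {for x, continuous G} ->
  (forall d, 0 < d -> exists y z, [/\ `|x - y| < d, `|x - z| < d & F y = G z]) ->
  F x = G x.
Proof.
move=> Fc Gc FG.
apply/eqP; rewrite -subr_eq0 -normr_le0; apply/ler_addgt0Pr => e e0; rewrite add0r.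
have e2 : 0 < e / 2 by rewrite divr_gt0.
have /cvgrPdist_lt/(_ (e / 2) e2) /nbhs_normP[a /= a0 aP] := Fc.
have /cvgrPdist_lt/(_ (e / 2) e2) /nbhs_normP[b /= b0 bP] := Gc.
have [|y [z [yx zx E]]] := FG (Num.min a b); first by rewrite lt_min a0 b0.
rewrite !lt_min in yx zx; case/andP: yx => /aP Fy _; case/andP: zx => _ /bP Gz.
have -> : F x - G x = (F x - F y) - (G x - G z) by rewrite E opprB addrA subrK.
by rewrite (le_trans (ler_normB _ _)) // (splitr e) lerD // ltW.
Qed.

(** Schwarz's theorem. The second difference of [f] is symmetric in [u] and [v],
    and [mixed_difference] expresses it by either mixed derivative at points as
    close to [x] as desired. *)
Lemma derive_swap f x u v :
  (forall y, derivable f y u) -> (forall y, derivable f y v) ->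
  (forall y, derivable ('D_u f) y v) -> (forall y, derivable ('D_v f) y u) ->
  {for x, continuous ('D_v ('D_u f))} -> {for x, continuous ('D_u ('D_v f))} ->
  'D_v ('D_u f) x = 'D_u ('D_v f) x.
Proof.
move=> du dv duv dvu uvc vuc; apply: (continuous_eq_near uvc vuc) => d d0.
pose n := `|u| + `|v| + 1.
have n0 : 0 < n by rewrite ltr_wpDl // addr_ge0.
pose h := d / n; have h0 : 0 < h by rewrite divr_gt0.
have near_x s r : 0 < s < h -> 0 < r < h -> `|x - (x + (s *: u + r *: v))| < d.
  move=> /andP[s0 sh] /andP[r0 rh]; rewrite opprD addNKr normrN.
  rewrite (le_lt_trans (ler_normD _ _)) // !normrZ !gtr0_norm //.
  have -> : d = h * `|u| + h * `|v| + h by rewrite /h /n; field; rewrite -/n gt_eqF.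
  by rewrite -[X in X < _]addr0 ler_ltD // lerD // ler_wpM2r // ltW.
have [s [r [sh rh E1]]] := mixed_difference x h0 du duv.
have [r' [s' [rh' sh' E2]]] := mixed_difference x h0 dv dvu.
exists (x + s *: u + r *: v), (x + r' *: v + s' *: u); split.
- by rewrite -addrA; exact: near_x.
- by rewrite -addrA [r' *: v + _]addrC; exact: near_x.
apply: (mulfI (lt0r_neq0 h0)); apply: (mulfI (lt0r_neq0 h0)).
apply: (etrans (esym E1)); apply: (etrans _ E2).
by rewrite (addrAC x (h *: v)); congr (_ + _); exact: addrAC.
Qed.
End Schwarz.

(** * The fundamental solution is symplectic *)

Section Liouville.
Local Open Scope classical_set_scope.
Context {R : realType}.

Lemma continuous_slice {U V W : topologicalType} (h : U * V -> W) y t :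
  {for (y, t), continuous h} -> {for y, continuous (fun z => h (z, t))}.
Proof.
move=> hc; have pc : (z, t) @[z --> y] --> (y, t).
  by apply: cvg_pair; [exact: cvg_id | exact: cvg_cst].
exact: cvg_comp pc hc.
Qed.

Lemma continuous_coord_at {U : topologicalType} m n (f : U -> 'M[R]_(m, n)) y i j :
  {for y, continuous f} -> {for y, continuous (fun z => f z i j)}.
Proof. by move=> fc; exact: cvg_coord. Qed.

Lemma hessH_sym (H : 'cV[R]_2 -> R -> R) y t i j : regular_hamiltonian H ->
  hessH H y t i j = hessH H y t j i.
Proof.
move=> [H1 H2 Hc].
have entryc k l : {for y, continuous ('D_(basis_vec k) (partial l (H ^~ t)))}.
  have -> : 'D_(basis_vec k) (partial l (H ^~ t)) = fun z => hessH H z t k l.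
    by apply/funext => z; rewrite mxE.
  exact: continuous_coord_at (continuous_slice (Hc (y, t))).
have hessE k l : hessH H y t k l = 'D_(basis_vec k) ('D_(basis_vec l) (H ^~ t)) y.
  by rewrite mxE.
rewrite (hessE i j) (hessE j i).
apply: (@derive_swap R 'cV[R]_2 (H ^~ t) y (basis_vec j) (basis_vec i)).
- by move=> z; exact: H1.
- by move=> z; exact: H1.
- by move=> z; exact: (H2 t z i j).
- by move=> z; exact: (H2 t z j i).
- exact: (entryc i j).
- exact: (entryc j i).
Qed.

Lemma is_derive_coord {V : normedModType R} m n (M : V -> 'M[R]_(m, n)) x v dM i j :
  is_derive x v M dM -> is_derive x v (fun y => M y i j) (dM i j).
Proof.
move=> [dMx <-]; split; first by move/derivable_mxP : dMx; exact.
by rewrite derive_mx // mxE.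
Qed.

(** Liouville's formula: the logarithmic derivative of the determinant is the
    trace of the coefficient matrix. *)
Lemma det_constant_traceless (A M : R -> 'M[R]_2) : (forall t, \tr (A t) = 0) ->
  (forall t : R, is_derive t 1 M (A t *m M t)) -> forall t, \det (M t) = \det (M 0).
Proof.
move=> trA dM t; rewrite !det2.
pose d r := M r 0 0 * M r 1 1 - M r 0 1 * M r 1 0.
apply: (@is_derive_0_is_cst _ d) => r.
have dE i j := is_derive_coord i j (dM r).
apply: (is_derive_eq (is_deriveB (is_deriveM (dE 0 0) (dE 1 1))
  (is_deriveM (dE 0 1) (dE 1 0)))).
have trr := trA r; rewrite mxtrace2 in trr.
rewrite /GRing.scale /= !mulmx2E.
have -> : A r 1 1 = - A r 0 0 by lra.
ring.
Qed.

Lemma continuous_is_derive (M : R -> 'M[R]_2) dM :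
  (forall t : R, is_derive t 1 M (dM t)) -> continuous M.
Proof.
move=> dMt t; apply: differentiable_continuous; apply/derivable1_diffP.
exact: ex_derive.
Qed.

(** The trace of [J2 *m S] is [S 0 1 - S 1 0], which vanishes by the symmetry of
    the Hessian. *)
Lemma fundamental_solution_det H x (gamma : R -> 'M[R]_2) :
  regular_hamiltonian H -> fundamental_solution H x gamma ->
  continuous gamma /\ forall t, \det (gamma t) = 1.
Proof.
move=> Hreg [g0 dg]; split; first exact: continuous_is_derive dg.
move=> t; rewrite -(det1 R 2) -g0; apply: det_constant_traceless dg t => t.
rewrite mxtrace2 /J2 !(mulmx2E, mx2E) (hessH_sym _ _ 0 1) //; ring.
Qed.
End Liouville.

(** * Paths from the negative component to its representative *)

Section Extension.
Local Open Scope classical_set_scope.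
Context {R : realType}.

Lemma Sp2minusE (A : 'M[R]_2) : Sp2minus A <-> \det A = 1 /\ \tr A < 2.
Proof.
rewrite /Sp2minus /= Sp2_det.
by split=> -[dA]; rewrite det2_sub_scalar dA expr1n mulr1 => h; split=> //; lra.
Qed.

Lemma Sp2plusE (A : 'M[R]_2) : Sp2plus A <-> \det A = 1 /\ 2 < \tr A.
Proof.
rewrite /Sp2plus /= Sp2_det.
by split=> -[dA]; rewrite det2_sub_scalar dA expr1n mulr1 => h; split=> //; lra.
Qed.

(** Composing with this truncation gives paths defined and continuous on the
    whole line that stay at their end points outside [0, 1]; such paths are glued
    by multiplying them. *)
Definition unit_clamp (s : R) : R := Num.max 0 (Num.min s 1).

Lemma unit_clamp_ge0 s : 0 <= unit_clamp s.
Proof. by rewrite /unit_clamp le_max lexx. Qed.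

Lemma unit_clamp_le1 s : unit_clamp s <= 1.
Proof. by rewrite /unit_clamp ge_max ler01 ge_min lexx orbT. Qed.

Lemma unit_clamp_eq0 s : s <= 0 -> unit_clamp s = 0.
Proof. by move=> s0; rewrite /unit_clamp max_l // ge_min s0. Qed.

Lemma unit_clamp_eq1 s : 1 <= s -> unit_clamp s = 1.
Proof. by move=> s1; rewrite /unit_clamp min_r // max_r // ler01. Qed.

Lemma continuous_unit_clamp : continuous unit_clamp.
Proof.
apply: continuous_maxr; first by move=> ?; exact: cvg_cst.
by apply: continuous_minr => ?; [exact: cvg_id | exact: cvg_cst].
Qed.

(** The segment from [M] to the opposite of the identity, rescaled to determinant
    1. The determinant of [a M - c] is [(a - c)^2 + a c (2 - \tr M)], which is
    positive as long as the trace of [M] is below 2. *)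
Lemma Sp2minus_path_to_opp1 (M : 'M[R]_2) : \det M = 1 -> \tr M < 2 ->
  exists S : R -> 'M[R]_2, [/\ continuous S, forall s, Sp2minus (S s),
    forall s, s <= 0 -> S s = M & forall s, 1 <= s -> S s = mx2 (-1) 0 0 (-1)].
Proof.
move=> dM tM.
pose c := unit_clamp; pose a s := 1 - c s.
pose q s := a s ^+ 2 - a s * c s * \tr M + c s ^+ 2.
pose r s := (Num.sqrt (q s))^-1.
pose S s := mx2 (r s * (a s * M 0 0 - c s)) (r s * (a s * M 0 1))
                (r s * (a s * M 1 0)) (r s * (a s * M 1 1 - c s)).
have c0 s : 0 <= c s := unit_clamp_ge0 s.
have a0 s : 0 <= a s by rewrite subr_ge0 unit_clamp_le1.
have ac s : a s + c s = 1 by rewrite subrK.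
have q0 s : 0 < q s.
  have -> : q s = (a s - c s) ^+ 2 + a s * c s * (2 - \tr M) by rewrite /q; ring.
  have : 0 <= a s * c s by exact: mulr_ge0.
  rewrite le_eqVlt => /orP[/eqP ac0|ac0].
    rewrite (_ : (a s - c s) ^+ 2 = (a s + c s) ^+ 2 - 4 * (a s * c s)); last by ring.
    by rewrite -ac0 ac; lra.
  by rewrite ltr_wpDl ?sqr_ge0 // mulr_gt0 // subr_gt0.
have w0 s : 0 < Num.sqrt (q s) by rewrite sqrtr_gt0.
have w2 s : Num.sqrt (q s) ^+ 2 = q s by rewrite sqr_sqrtr // ltW.
have cc : continuous c := continuous_unit_clamp.
have acont : continuous a by move=> s; apply: cvgB; [exact: cvg_cst | exact: cc].
have qc : continuous q.
  move=> s; apply: cvgD; last by apply: (cvgM (f := c) (g := c)); exact: cc.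
  apply: cvgB; first by apply: (cvgM (f := a) (g := a)); exact: acont.
  by apply: cvgM; [apply: cvgM; [exact: acont | exact: cc] | exact: cvg_cst].
have rc : continuous r.
  move=> s; apply: cvgV; first by rewrite gt_eqF.
  by apply: (continuous_comp (f := q)); [exact: qc | exact: sqrt_continuous].
exists S; split.
- have entry x : continuous (fun s => r s * (a s * x)).
    move=> s; apply: cvgM; first exact: rc.
    by apply: cvgM; [exact: acont | exact: cvg_cst].
  have diag x : continuous (fun s => r s * (a s * x - c s)).
    move=> s; apply: cvgM; first exact: rc.
    by apply: cvgB; [apply: cvgM; [exact: acont | exact: cvg_cst] | exact: cc].
  exact: continuous_mx2.
- move=> s; apply/Sp2minusE; rewrite det2 mxtrace2 !mx2E; split.
    have -> : r s * (a s * M 0 0 - c s) * (r s * (a s * M 1 1 - c s)) -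
      r s * (a s * M 0 1) * (r s * (a s * M 1 0)) =
      r s ^+ 2 * (a s ^+ 2 * \det M - a s * c s * \tr M + c s ^+ 2).
      by rewrite det2 mxtrace2; ring.
    by rewrite dM mulr1 -/(q s) -w2 exprVn mulVf // expf_neq0 // gt_eqF.
  have -> : r s * (a s * M 0 0 - c s) + r s * (a s * M 1 1 - c s) =
    (a s * \tr M - 2 * c s) / Num.sqrt (q s) by rewrite mxtrace2 /r; ring.
  rewrite ltr_pdivrMr //.
  (* If the left side is positive then so are the trace and [a s], and both sides
     may be squared; the difference of the squares is [a^2 (4 - (\tr M)^2)]. *)
  have [x_le0|x_gt0] := leP (a s * \tr M - 2 * c s) 0.
    by rewrite (le_lt_trans x_le0) // mulr_gt0.
  have at0 : 0 < a s * \tr M by have := c0 s; lra.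
  have a_gt0 : 0 < a s.
    by rewrite lt_neqAle a0 andbT; apply: contraTneq at0 => <-; rewrite mul0r ltxx.
  have t_gt0 : 0 < \tr M by rewrite pmulr_rgt0 in at0.
  rewrite -ltr_sqr ?nnegrE ?(ltW x_gt0) ?mulr_ge0 ?(ltW (w0 s)) // exprMn w2 -subr_gt0.
  have -> : 2 ^+ 2 * q s - (a s * \tr M - 2 * c s) ^+ 2 =
    a s ^+ 2 * ((2 - \tr M) * (2 + \tr M)) by rewrite /q; ring.
  by rewrite !mulr_gt0 ?exprn_gt0 // ?subr_gt0 // addr_gt0.
- move=> s s0; have cE : c s = 0 := unit_clamp_eq0 s0.
  have aE : a s = 1 by rewrite /a cE subr0.
  have rE : r s = 1 by rewrite /r (_ : q s = 1) ?sqrtr1 ?invr1 // /q cE aE; ring.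
  by apply: mx2_eq; rewrite mx2E rE aE ?cE !mul1r ?subr0.
- move=> s s1; have cE : c s = 1 := unit_clamp_eq1 s1.
  have aE : a s = 0 by rewrite /a cE subrr.
  have rE : r s = 1 by rewrite /r (_ : q s = 1) ?sqrtr1 ?invr1 // /q cE aE; ring.
  by rewrite /S rE aE cE !(mul0r, mul1r, mulr0, sub0r).
Qed.

Lemma Sp2minus_path_from_opp1 :
  exists S : R -> 'M[R]_2, [/\ continuous S, forall s, Sp2minus (S s),
    forall s, s <= 0 -> S s = mx2 (-1) 0 0 (-1) & forall s, 1 <= s -> S s = Mminus].
Proof.
pose x s := 1 + unit_clamp s; pose S s := mx2 (- x s) 0 0 (- (x s)^-1).
have x0 s : 0 < x s by rewrite ltr_wpDr // unit_clamp_ge0.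
have xc : continuous x.
  by move=> s; apply: cvgD; [exact: cvg_cst | exact: continuous_unit_clamp].
exists S; split.
- apply: continuous_mx2 => s; try exact: cvg_cst.
    by apply: cvgN; exact: xc.
  by apply: cvgN; apply: cvgV; [rewrite gt_eqF | exact: xc].
- move=> s; apply/Sp2minusE; rewrite det2 mxtrace2 !mx2E mulrNN mulfV ?gt_eqF //.
  split; first by rewrite mulr0 subr0.
  have xV0 : 0 < (x s)^-1 by rewrite invr_gt0.
  by have := x0 s; lra.
- by move=> s s0; rewrite /S /x unit_clamp_eq0 // addr0 invr1.
- by move=> s s1; rewrite /S /x unit_clamp_eq1.
Qed.

Lemma Sp2minus_path (M : 'M[R]_2) : Sp2minus M ->
  exists S : R -> 'M[R]_2, [/\ continuous S, forall s, Sp2minus (S s),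
    forall s, s <= 0 -> S s = M & forall s, 1 <= s -> S s = Mminus].
Proof.
move=> /Sp2minusE[dM tM].
have [P [Pc Pm P0 P1]] := Sp2minus_path_to_opp1 dM tM.
have [Q [Qc Qm Q0 Q1]] := Sp2minus_path_from_opp1.
have opp1 : mx2 (-1) 0 0 (-1) *m mx2 (-1) 0 0 (-1) = 1%:M :> 'M[R]_2.
  by apply: mx2_eq; rewrite !(mulmx2E, mx2E, mxE) /=; ring.
exists (fun s => P (2 * s) *m (mx2 (-1) 0 0 (-1) *m Q (2 * s - 1))); split.
- apply: continuous_mulmx2.
    move=> s; apply: (continuous_comp (f := fun s : R => 2 * s) (g := P)).
      by apply: cvgM; [exact: cvg_cst | exact: cvg_id].
    exact: Pc.
  apply: continuous_mulmx2; first by move=> s; exact: cvg_cst.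
  move=> s; apply: (continuous_comp (f := fun s : R => 2 * s - 1) (g := Q)).
    apply: cvgB; last exact: cvg_cst.
    by apply: cvgM; [exact: cvg_cst | exact: cvg_id].
  exact: Qc.
- move=> s; have [h|h] := leP (2 * s) 1.
    by rewrite Q0 ?opp1 ?mulmx1 // subr_le0.
  by rewrite P1 ?mulmxA ?opp1 ?mul1mx // ltW.
- move=> s s0; rewrite Q0 ?opp1 ?mulmx1 ?P0 //; lra.
- move=> s s1; rewrite P1 ?mulmxA ?opp1 ?mul1mx ?Q1 //; lra.
Qed.

(** The extension is the product of the path stopped at [tau] with the inverse of
    its value there and a path that starts only at [tau]; at each time one of the
    two outer factors is at rest. *)
Lemma CZ_extension_exists (tau : R) (gamma : R -> 'M[R]_2) : 0 < tau ->
  continuous gamma -> (forall t, \det (gamma t) = 1) -> Sp2minus (gamma tau) ->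
  exists gamma' : R -> 'M[R]_2,
    [/\ continuous gamma', forall t, \det (gamma' t) = 1,
    CZ_extension tau gamma gamma' & gamma' (2 * tau) = Mminus].
Proof.
move=> tau0 gc g1 gm.
have [S [Sc Sm S0 S1]] := Sp2minus_path gm.
have gU : gamma tau \in unitmx by rewrite unitmxE g1 unitr1.
pose gamma' t :=
  gamma (Num.min t tau) *m (invmx (gamma tau) *m S ((t - tau) / tau)).
have before t : t <= tau -> gamma' t = gamma t.
  move=> tt; rewrite /gamma' min_l // S0 ?mulVmx ?mulmx1 //.
  by rewrite mulr_le0_ge0 ?invr_ge0 ?(ltW tau0) ?subr_le0 //.
have after t : tau <= t -> gamma' t = S ((t - tau) / tau).
  by move=> tt; rewrite /gamma' min_r // mulKVmx.
have ends : gamma' (2 * tau) = Mminus.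
  rewrite after; last by lra.
  by rewrite S1 // (_ : 2 * tau - tau = tau) ?divff ?gt_eqF //; ring.
have det1' t : \det (gamma' t) = 1.
  have [tt|/ltW tt] := leP t tau; first by rewrite before.
  by rewrite after //; have /Sp2minusE[] := Sm ((t - tau) / tau).
have g'c : continuous gamma'.
  apply: continuous_mulmx2.
    move=> t; apply: (continuous_comp (f := fun t : R => Num.min t tau)
      (g := gamma)); last exact: gc.
    by apply: continuous_minr => ?; [exact: cvg_id | exact: cvg_cst].
  apply: continuous_mulmx2; first by move=> s; exact: cvg_cst.
  move=> t; apply: (continuous_comp (f := fun t : R => (t - tau) / tau)
    (g := S)); last exact: Sc.
  apply: cvgM; last exact: cvg_cst.
  by apply: cvgB; [exact: cvg_id | exact: cvg_cst].
exists gamma'; split=> //; split=> //.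
- exact: continuous_subspaceT.
- by move=> t _; apply/Sp2_det.
- by move=> t /andP[_]; exact: before.
- by right; split=> // t /andP[tt _]; rewrite after.
Qed.

End Extension.

(** * Parity of the index *)

Section Index.
Local Open Scope classical_set_scope.
Context {R : realType}.

(** The component containing [gamma tau] is told by the trace, and the rotation
    at the end of every extension is 1 in the positive component and -1 in the
    negative one; [rotation_loop_degree_parity] turns this into the parity of the
    degree. The default value 0 of the index is even, so an extension together
    with a degree has to be produced only when the trace is below 2. *)
Lemma CZindex_parity (tau : R) (gamma : R -> 'M[R]_2) : 0 < tau ->
  continuous gamma -> (forall t, \det (gamma t) = 1) -> gamma 0 = 1%:M ->
  odd `|CZindex tau gamma|%N = (\tr (gamma tau) < 2).
Proof.
move=> tau0 gc g1 g0.
have tau2 : 0 <= 2 * tau by rewrite mulr_ge0 // ltW.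
have tr_plus : \tr (Mplus : 'M[R]_2) = 5 / 2 by rewrite mxtrace2 !mx2E; field.
have tr_minus : \tr (Mminus : 'M[R]_2) = - (5 / 2) by rewrite mxtrace2 !mx2E; field.
rewrite /CZindex; case: xgetP => [k _ /= [gamma' [g'c g'Sp g'E ends] deg]|none].
  have g'1 t : 0 <= t <= 2 * tau -> \det (gamma' t) = 1.
    by move=> /g'Sp /Sp2_det.
  have g'0 : gamma' 0 = 1%:M by rewrite g'E ?g0 // lexx ltW.
  have g'tau : gamma' tau = gamma tau by rewrite g'E // lexx ltW.
  have tau_in : tau <= tau <= 2 * tau by rewrite lexx /=; lra.
  have parity := rotation_loop_degree_parity tau2 g'c g'1 g'0 _ deg.
  case: ends => -[/(_ tau tau_in) + endE]; rewrite g'tau endE in parity *.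
    move=> /Sp2plusE[_ tr_gt2]; rewrite ltNge ltW //=.
    rewrite tr_plus in parity.
    have := parity ltac:(lra); rewrite gtr0_sg ?divr_gt0 //.
    by case: odd => //; rewrite expr1 => sgE; exfalso; lra.
  move=> /Sp2minusE[_ ->]; rewrite tr_minus in parity.
  have := parity ltac:(lra); rewrite ltr0_sg ?oppr_lt0 ?divr_gt0 //.
  by case: odd => //; rewrite expr0 => sgE; exfalso; lra.
apply/esym/negbTE/negP => trlt.
have gm : Sp2minus (gamma tau) by apply/Sp2minusE.
have [gamma' [g'c g'1 ext endE]] := CZ_extension_exists tau0 gc g1 gm.
have g'0 : gamma' 0 = 1%:M by case: ext => _ _ gE _; rewrite gE ?g0 // lexx ltW.
have [k deg] := @rotation_loop_degree_exists _ gamma' (2 * tau) tau2 g'c g'1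
  ltac:(by rewrite g'0 mxtrace1 -natrX ler_nat) ltac:(by rewrite endE tr_minus; lra).
by apply: (none k); exists gamma'.
Qed.

(** One of the two factors is always at rest, at [gamma 0] or at [gamma T];
    in this form continuity and the determinant need no case distinction. *)
Lemma iterate2E (T : R) (gamma : R -> 'M[R]_2) t : gamma 0 = 1%:M ->
  iterate2 T gamma t = gamma (Num.max 0 (t - T)) *m gamma (Num.min t T).
Proof.
move=> g0; rewrite /iterate2; case: (leP t T) => tT.
  by rewrite max_l ?subr_le0 // g0 mul1mx.
by rewrite max_r // subr_ge0 ltW.
Qed.

Lemma continuous_iterate2 (T : R) (gamma : R -> 'M[R]_2) :
  continuous gamma -> gamma 0 = 1%:M -> continuous (iterate2 T gamma).
Proof.
move=> gc g0.
have -> : iterate2 T gamma =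
    fun t => gamma (Num.max 0 (t - T)) *m gamma (Num.min t T).
  by apply/funext => t; exact: iterate2E.
apply: continuous_mulmx2 => t.
  apply: (continuous_comp (f := fun t : R => Num.max 0 (t - T))
    (g := gamma)); last exact: gc.
  apply: continuous_maxr => s; first exact: cvg_cst.
  by apply: cvgB; [exact: cvg_id | exact: cvg_cst].
apply: (continuous_comp (f := fun t : R => Num.min t T)
  (g := gamma)); last exact: gc.
by apply: continuous_minr => ?; [exact: cvg_id | exact: cvg_cst].
Qed.

End Index.

Theorem theorem6 (R : realType) (T : R) (H : 'cV[R]_2 -> R -> R)
    (x : R -> 'cV[R]_2) (gamma : R -> 'M[R]_2)
    (T_gt0 : 0 < T)
    (H_regular : regular_hamiltonian H)
    (H_periodic : forall y : 'cV[R]_2, periodic (H y) T)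
    (x_periodic : periodic x T)
    (x_solution : hamiltonian_solution H x)
    (gamma_fundamental : fundamental_solution H x gamma)
    (x_nondegenerate : nondegenerate_path T gamma)
    (x2_nondegenerate : nondegenerate_path (2 * T) (iterate2 T gamma)) :
  (elliptic (gamma T) <-> odd `|CZindex (2 * T) (iterate2 T gamma)|%N) /\
  (hyperbolic (gamma T) <-> ~~ odd `|CZindex (2 * T) (iterate2 T gamma)|%N).
Proof.
have [gc g1] := fundamental_solution_det H_regular gamma_fundamental.
have g0 : gamma 0 = 1%:M by case: gamma_fundamental.
have T2_gt0 : 0 < 2 * T by rewrite mulr_gt0.
have it1 t : \det (iterate2 T gamma t) = 1.
  by rewrite iterate2E // det_mulmx !g1 mulr1.
have it0 : iterate2 T gamma 0 = 1%:M by rewrite /iterate2 ltW.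
have itT : iterate2 T gamma (2 * T) = gamma T *m gamma T.
  by rewrite iterate2E // max_r ?min_r; [congr (gamma _ *m _); ring | lra | lra].
have tr_it : \tr (iterate2 T gamma (2 * T)) = \tr (gamma T) ^+ 2 - 2.
  by rewrite itT mxtrace2_sqr g1 mulr1.
have tr_neq : \tr (gamma T) ^+ 2 != 4.
  apply: contraNneq x2_nondegenerate => trE.
  by rewrite det2_sub_scalar it1 tr_it trE; apply/eqP; ring.
rewrite (CZindex_parity T2_gt0 (continuous_iterate2 gc g0) it1 it0).
rewrite tr_it ltrBlDr (_ : 2 + 2 = 4); last by ring.
by split; [exact: ellipticP | exact: hyperbolicP].
Qed.
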